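(* Let $\mathcal{X}$ be a real Banach space with $\dim(\mathcal{X})\ge 2$ and let $\kappa,\tau>0$. If $\mathcal{T}_1(\kappa,\tau,\mathcal{X})<\kappa+\tau$, then $\mathcal{X}$ is uniformly non-square.
   Context: $S_{\mathcal{X}}$ denotes the unit sphere of $\mathcal{X}$. For $\kappa,\tau>0$, $$\mathcal{T}_1(\kappa,\tau,\mathcal{X})=\sup_{x_1,x_2\in S_{\mathcal{X}}}\big(\|\kappa x_1+\tau x_2\|\,\|\kappa x_1-\tau x_2\|\big)^{1/2}.$$ $\mathcal{X}$ is uniformly non-square if there exists $\delta\in(0,1)$ such that for all $x_1,x_2\in S_{\mathcal{X}}$, $\min\left\{\left\|\frac{x_1+x_2}{2}\right\|,\left\|\frac{x_1-x_2}{2}\right\|\right\}\le 1-\delta$. *)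

(* Defs.v *)
From HB Require Import structures.
From mathcomp Require Import all_boot all_order all_algebra.
From mathcomp Require Import all_classical all_reals all_analysis.
Import Order.TTheory GRing.Theory Num.Theory.
Import numFieldNormedType.Exports.

Set Implicit Arguments.
Unset Strict Implicit.
Unset Printing Implicit Defensive.

Local Open Scope classical_set_scope.
Local Open Scope ring_scope.

(* [dim_ge V n] means dim V >= n, where V may be infinite-dimensional: V
   contains n linearly independent vectors. *)
Definition dim_ge (R : realType) (V : lmodType R) (n : nat) : Prop :=
  exists e : 'I_n -> V,
    forall c : 'I_n -> R, \sum_(i < n) c i *: e i = 0 -> forall i, c i = 0.

Definition unit_sphere (R : realType) (X : normedModType R) : set X :=
  [set x | `|x| = 1].
Arguments unit_sphere {R} X _.

(* The supremum is the real-valued [sup], which is 0 on empty or unbounded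
   sets. For kappa, tau > 0 the set is bounded above by kappa + tau, and it is
   nonempty as soon as X is nonzero. *)
Definition T1 (R : realType) (kappa tau : R) (X : normedModType R) : R :=
  sup [set Num.sqrt (`|kappa *: p.1 + tau *: p.2| *
                     `|kappa *: p.1 - tau *: p.2|)
      | p in unit_sphere X `*` unit_sphere X].

Definition uniformly_nonsquare (R : realType) (X : normedModType R) : Prop :=
  exists delta : R, [/\ 0 < delta, delta < 1 &
    forall x1 x2 : X, unit_sphere X x1 -> unit_sphere X x2 ->
      Num.min `|2^-1 *: (x1 + x2)| `|2^-1 *: (x1 - x2)| <= 1 - delta].

(* Main.v *)
Require Import Defs.
From mathcomp Require Import all_boot all_order all_algebra.
From mathcomp Require Import all_classical all_reals all_analysis.
From mathcomp Require Import ring lra.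
Import Order.TTheory GRing.Theory Num.Theory.
Import numFieldNormedType.Exports.
Local Open Scope ring_scope.

(** The contrapositive is quantitative.  If unit vectors [x1], [x2] make both
    [x1 + x2] and [x1 - x2] almost as long as the triangle inequality allows,
    then they do the same for [kappa *: x1 + tau *: x2] and
    [kappa *: x1 - tau *: x2], because, up to signs,
    [[
      kappa *: x1 + tau *: x2
        = (kappa + tau) *: (x1 + x2) - (tau *: x1 + kappa *: x2)
    ]]
    and the subtracted vector has norm at most [kappa + tau].  Hence
    [`|x1 + x2| / 2 > 1 - delta] gives
    [`|kappa *: x1 + tau *: x2| > (kappa + tau) * (1 - 2 * delta)]
    ([norm_combination_gt]), and the same bound for the difference follows on
    replacing [x2] by its opposite.  For the [delta] such that
    [(kappa + tau) * (1 - 2 * delta)] is exactly [T1 kappa tau X], the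
    geometric mean of the two norms would exceed the supremum defining
    [T1 kappa tau X]; so this [delta] witnesses uniform non-squareness. *)

Section CombinationsOfUnitVectors.
Context {R : realType} {X : normedModType R}.
Implicit Types (x : X) (a b : R).

Lemma norm_combination_le a b x1 x2 : 0 <= a -> 0 <= b ->
  unit_sphere X x1 -> unit_sphere X x2 -> `|a *: x1 + b *: x2| <= a + b.
Proof.
rewrite /unit_sphere /= => a0 b0 x1E x2E; apply: le_trans (ler_normD _ _) _.
by rewrite !normrZ x1E x2E !mulr1 !ger0_norm.
Qed.

Lemma unit_sphereN x : unit_sphere X x -> unit_sphere X (- x).
Proof. by rewrite /unit_sphere /= normrN. Qed.

(** Enlarging both coefficients to [a + b] costs the swapped combination
    [b *: x1 + a *: x2], whose norm is at most [a + b]; this symmetric choice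
    avoids comparing [a] with [b]. *)
Lemma norm_combination_gt a b d x1 x2 : 0 < a -> 0 < b ->
  unit_sphere X x1 -> unit_sphere X x2 -> 1 - d < `|2^-1 *: (x1 + x2)| ->
  (a + b) * (1 - 2 * d) < `|a *: x1 + b *: x2|.
Proof.
move=> a0 b0 x1S x2S; rewrite normrZ ger0_norm ?invr_ge0 // => dlt.
have swapped := norm_combination_le _ _ _ _ (ltW b0) (ltW a0) x1S x2S.
have split_sum : (a + b) *: (x1 + x2) =
    (a *: x1 + b *: x2) + (b *: x1 + a *: x2).
  by rewrite addrACA -!scalerDl [b + a]addrC -scalerDr.
have := ler_normD (a *: x1 + b *: x2) (b *: x1 + a *: x2).
rewrite -split_sum normrZ ger0_norm; last by rewrite addr_ge0 ?ltW.
have : (a + b) * (2 * (1 - d)) < (a + b) * `|x1 + x2|.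
  by rewrite ltr_pM2l ?addr_gt0 //; lra.
by lra.
Qed.

(** An unbounded set of values would have [sup] equal to 0, so being below
    [T1 a b X] needs the bound [a + b] on both factors. *)
Lemma T1_ge a b x1 x2 : 0 < a -> 0 < b ->
  unit_sphere X x1 -> unit_sphere X x2 ->
  Num.sqrt (`|a *: x1 + b *: x2| * `|a *: x1 - b *: x2|) <= T1 a b X.
Proof.
move=> a0 b0 x1S x2S; apply: ub_le_sup; last by exists (x1, x2).
exists (a + b) => _ [[y1 y2] /= [y1S y2S] <-].
have ab0 : 0 <= a + b by rewrite addr_ge0 ?ltW.
rewrite -[leRHS](ger0_norm ab0) -sqrtr_sqr expr2 ler_wsqrtr //.
apply: ler_pM => //; first by apply: norm_combination_le => //; exact: ltW.
by rewrite -scalerN norm_combination_le ?ltW //; exact: unit_sphereN.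
Qed.

Lemma T1_ge0 a b : 0 <= T1 a b X.
Proof.
rewrite /T1; set E := (X in sup X).
have [|noSup] := pselect (has_sup E); last by rewrite sup_out.
move=> [[y Ey] ubE]; apply: le_trans (ub_le_sup ubE Ey).
by case: Ey => p _ <-; exact: sqrtr_ge0.
Qed.

End CombinationsOfUnitVectors.

Theorem theorem2 (R : realType) (X : completeNormedModType R)
    (hdim : dim_ge X 2) (kappa tau : R) (hkappa : 0 < kappa) (htau : 0 < tau)
    (hT1 : T1 kappa tau X < kappa + tau) :
  uniformly_nonsquare X.
Proof.
have kt0 : 0 < kappa + tau by rewrite addr_gt0.
set t := T1 kappa tau X in hT1 *.
have t0 : 0 <= t by exact: T1_ge0.
pose delta := (1 - t / (kappa + tau)) / 2.
have deltaE : (kappa + tau) * (1 - 2 * delta) = t.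
  by rewrite /delta; field; rewrite gt_eqF.
have q0 : 0 <= t / (kappa + tau) by exact: divr_ge0 (ltW kt0).
have q1 : t / (kappa + tau) < 1 by rewrite ltr_pdivrMr ?mul1r.
have delta0 : 0 < delta by rewrite /delta; lra.
have delta1 : delta < 1 by rewrite /delta; lra.
exists delta; split=> //.
move=> x1 x2 x1S x2S; rewrite leNgt lt_min; apply/negP => /andP[sumlt difflt].
have := norm_combination_gt _ _ _ _ _ hkappa htau x1S x2S sumlt.
have := norm_combination_gt _ _ _ _ _ hkappa htau x1S (unit_sphereN _ x2S) difflt.
rewrite deltaE scalerN => tdiff tsum.
have := T1_ge _ _ _ _ hkappa htau x1S x2S.
rewrite -/t leNgt => /negP; apply.
rewrite -[ltLHS](ger0_norm t0) -sqrtr_sqr ltr_sqrt; last first.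
  by rewrite mulr_gt0 // (le_lt_trans t0).
by rewrite expr2 ltr_pM.
Qed.
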